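(* There is a one-to-one correspondence between $K$-$K$ sub-bimodules of $K\otimes_F K$ and $H$-bisets $S\subseteq G$, given by $S\mapsto\sum_{HgH\subseteq S}K_{[g]}$.
   Context: Setting: $F$ is a field, $K/F$ is a finite separable field extension (a maximal separable subfield, with $[K:F]=n$, of a central simple $F$-algebra $A$ of degree $n$), $L$ is the Galois closure of $K/F$, $G=\mathrm{Gal}(L/F)$, $H=\mathrm{Gal}(L/K)$. $K\otimes_F K$ is regarded as a $K$-$K$-bimodule, i.e. as a module over itself. An $H$-biset is a subset $S\subseteq G$ closed under multiplication by $H$ from the left and from the right (the empty set is allowed), i.e. a union of double cosets of $H$. For $g\in G$ let $\pi_{gH}:K\otimes_F K\to L$ be the ring homomorphism $a\otimes b\mapsto a\,g(b)$. Its kernel depends only on $HgH$, and $K_{[g]}\subset K\otimes_F K$ is the unique minimal ideal of the (commutative semisimple) ring $K\otimes_F K$ not contained in $\ker\pi_{gH}$. *)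

(* Defs.v *)
From HB Require Import structures.
From mathcomp Require Import all_boot all_order all_fingroup all_algebra.
From mathcomp Require Import all_solvable all_field.
From mathcomp Require Import boolp classical_sets.

Set Implicit Arguments.
Unset Strict Implicit.
Unset Printing Implicit Defensive.

Import GRing.Theory.
Local Open Scope ring_scope.

(* The tensor product of two finite-dimensional spaces, represented by
   coordinates: x stands for \sum_(i, j) x i j *: (e_i (x) e'_j) where e and e'
   are the bases vbasis {:A} and vbasis {:B}. The universal property is
   tens_linearl, tens_linearr, tens_lift_linear, tens_liftE and tens_ext. *)
Section TensorSpace.
Variables (F : fieldType) (A B : vectType F).

Definition tensor : Type := 'M[F]_(\dim {:A}, \dim {:B}).

HB.instance Definition _ := Vector.on tensor.

Definition tens (a : A) (b : B) : tensor :=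
  \matrix_(i, j) (coord (vbasis {:A}) i a * coord (vbasis {:B}) j b).

(* the linear map tensor -> V induced by a bilinear map f *)
Definition tens_lift (V : lmodType F) (f : A -> B -> V) (x : tensor) : V :=
  \sum_i \sum_j x i j *: f (vbasis {:A})`_i (vbasis {:B})`_j.

Lemma tens_linearl b : linear (tens^~ b).
Proof.
by move=> c a a'; apply/matrixP=> i j; rewrite !mxE linearP mulrDl mulrA.
Qed.

Lemma tens_linearr a : linear (tens a).
Proof.
by move=> c b b'; apply/matrixP=> i j; rewrite !mxE linearP mulrDr mulrCA.
Qed.

Lemma tens_lift_linear (V : lmodType F) (f : A -> B -> V) :
  linear (tens_lift f).
Proof.
move=> c x y; rewrite /tens_lift scaler_sumr -big_split; apply: eq_bigr => i _.
rewrite /= scaler_sumr -big_split; apply: eq_bigr => j _.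
by rewrite /= !mxE scalerDl scalerA.
Qed.

Lemma tens_liftE (V : lmodType F) (f : A -> B -> V) :
  (forall b, linear (f^~ b)) -> (forall a, linear (f a)) ->
  forall a b, tens_lift f (tens a b) = f a b.
Proof.
move=> fl fr a b.
pose flH b := GRing.isLinear.Build F A V *:%R (f^~ b) (fl b).
pose frH a := GRing.isLinear.Build F B V *:%R (f a) (fr a).
pose gl b : {linear A -> V} := HB.pack (f^~ b) (flH b).
pose gr a : {linear B -> V} := HB.pack (f a) (frH a).
have sl (I : finType) (c : I -> F) (u : I -> A) v :
  f (\sum_i c i *: u i) v = \sum_i c i *: f (u i) v.
  rewrite -[LHS]/(gl v _) linear_sum; apply: eq_bigr => i _.
  by rewrite linearZ.
have sr (I : finType) (c : I -> F) u (v : I -> B) :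
  f u (\sum_i c i *: v i) = \sum_i c i *: f u (v i).
  rewrite -[LHS]/(gr u _) linear_sum; apply: eq_bigr => i _.
  by rewrite linearZ.
rewrite {2}(coord_vbasis (memvf a)) {2}(coord_vbasis (memvf b)) sl.
apply: eq_bigr => i _; rewrite sr scaler_sumr; apply: eq_bigr => j _.
by rewrite mxE scalerA.
Qed.

Lemma eq_tens_lift_linear (V : lmodType F) c (f g h : A -> B -> V) x :
  (forall a b, h a b = c *: f a b + g a b) ->
  tens_lift h x = c *: tens_lift f x + tens_lift g x.
Proof.
move=> hE; rewrite /tens_lift scaler_sumr -big_split; apply: eq_bigr => i _.
rewrite /= scaler_sumr -big_split; apply: eq_bigr => j _.
by rewrite /= hE scalerDr !scalerA mulrC.
Qed.

Lemma tens_ind (P : tensor -> Prop) :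
  (forall a b, P (tens a b)) -> (forall c x y, P x -> P y -> P (c *: x + y)) ->
  forall x, P x.
Proof.
move=> Pt PD.
have P0 : P 0.
  suff <- : tens 0 0 = 0 by [].
  by apply/matrixP=> i j; rewrite !mxE linear0 mul0r.
have PS (I : finType) (u : I -> tensor) : (forall i, P (u i)) -> P (\sum_i u i).
  move=> Pu; apply: big_ind => // y z Py Pz.
  by rewrite -[y]scale1r; apply: PD.
move=> x.
suff -> : x = \sum_i \sum_j
    x i j *: tens (vbasis {:A})`_i (vbasis {:B})`_j.
  apply: (PS) => i; apply: (PS) => j; rewrite -[_ *: _]addr0.
  exact: PD (Pt _ _) P0.
rewrite [LHS]matrix_sum_delta; apply: eq_bigr => i _; apply: eq_bigr => j _.
congr (_ *: _); apply/matrixP=> k l; rewrite !mxE.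
rewrite !coord_free ?(basis_free (vbasisP _)) //.
by rewrite -!natrM mulnb ![_ == i]eq_sym ![_ == j]eq_sym.
Qed.

Lemma tens_ext (V : lmodType F) (f g : tensor -> V) :
  linear f -> linear g -> (forall a b, f (tens a b) = g (tens a b)) -> f =1 g.
Proof. by move=> fL gL fg; apply: tens_ind => // c x y; rewrite fL gL => -> ->. Qed.

End TensorSpace.

(* The ring structure, characterized by (a (x) b)(c (x) d) = ac (x) bd. *)
Section TensorAlgebra.
Variables (F : fieldType) (A B : fieldExtType F).
Local Notation T := (tensor A B).

Definition tens_one : T := tens 1 1.

Definition tens_mul (x y : T) : T :=
  tens_lift (fun a b => tens_lift (fun c d => tens (a * c) (b * d)) y) x.

Lemma tens_mul_linearl y : linear (tens_mul^~ y).
Proof. exact: tens_lift_linear. Qed.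

Let tens_mul_tensl a b y : tens_mul (tens a b) y =
  tens_lift (fun c d => tens (a * c) (b * d)) y.
Proof.
rewrite /tens_mul tens_liftE // => [b' c u v|a' e u v];
  apply: eq_tens_lift_linear => a1 b1; rewrite mulrDl -scalerAl.
  exact: tens_linearl.
exact: tens_linearr.
Qed.

Lemma tens_mulE a b c d :
  tens_mul (tens a b) (tens c d) = tens (a * c) (b * d).
Proof.
rewrite tens_mul_tensl tens_liftE // => [d' e u v|c' e u v];
  rewrite mulrDr -scalerAr.
  exact: tens_linearl.
exact: tens_linearr.
Qed.

Lemma tens_mul_linearr x : linear (tens_mul x).
Proof.
move=> c y z; elim/tens_ind: x => [a b|d u v Hu Hv].
  by rewrite !tens_mul_tensl tens_lift_linear.
rewrite !tens_mul_linearl Hu Hv !scalerDr !scalerA [d * c]mulrC addrACA.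
by [].
Qed.

Lemma tens_mulC : commutative tens_mul.
Proof.
move=> x y; elim/tens_ind: x => [a b|c u v Hu Hv]; last first.
  by rewrite tens_mul_linearl tens_mul_linearr Hu Hv.
elim/tens_ind: y => [a' b'|c u v Hu Hv].
  by rewrite !tens_mulE mulrC [b * _]mulrC.
by rewrite tens_mul_linearl tens_mul_linearr Hu Hv.
Qed.

Lemma tens_mulA : associative tens_mul.
Proof.
move=> x y z; elim/tens_ind: x => [a b|c u v Hu Hv]; last first.
  by rewrite !tens_mul_linearl Hu Hv.
elim/tens_ind: y => [a' b'|c u v Hu Hv]; last first.
  by rewrite tens_mul_linearl !tens_mul_linearr tens_mul_linearl Hu Hv.
elim/tens_ind: z => [a1 b1|c u v Hu Hv]; last first.
  by rewrite !tens_mul_linearr Hu Hv.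
by rewrite !tens_mulE !mulrA.
Qed.

Lemma tens_mul1 : left_id tens_one tens_mul.
Proof.
elim/tens_ind => [a b|c u v Hu Hv]; first by rewrite tens_mulE !mul1r.
by rewrite tens_mul_linearr Hu Hv.
Qed.

Lemma tens_mulDl : left_distributive tens_mul +%R.
Proof.
by move=> x y z; rewrite -[x]scale1r tens_mul_linearl !scale1r.
Qed.

Lemma tens_one_neq0 : tens_one != 0.
Proof.
have ex (C : fieldExtType F) : exists i, coord (vbasis {:C}) i 1 != 0.
  apply/existsP; apply: contraNT (oner_neq0 C) => /existsPn c0.
  rewrite (coord_vbasis (memvf 1)) big1 // => i _.
  by move/negbNE/eqP: (c0 i) => ->; rewrite scale0r.
have [i ni] := ex A; have [j nj] := ex B.
apply: contraNneq (mulf_neq0 ni nj) => /matrixP/(_ i j).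
by rewrite !mxE => ->.
Qed.

HB.instance Definition _ := GRing.Zmodule_isComNzRing.Build T
  tens_mulA tens_mulC tens_mul1 tens_mulDl tens_one_neq0.

Lemma tens_scalerAl (c : F) (x y : T) : c *: (x * y) = c *: x * y.
Proof.
by have := tens_mul_linearl y c x 0; rewrite addr0 (mul0r (y : T) : tens_mul 0 y = 0) addr0.
Qed.

HB.instance Definition _ := GRing.Lmodule_isLalgebra.Build F T tens_scalerAl.
HB.instance Definition _ := GRing.Lalgebra_isComAlgebra.Build F T.

Lemma tensM a b c d : tens a b * tens c d = tens (a * c) (b * d) :> T.
Proof. exact: tens_mulE. Qed.

End TensorAlgebra.

(* Every ideal of A (x) B and every A-B sub-bimodule is an F-subspace, since F
   embeds in A; so these notions are predicates on {vspace _}. *)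
Section Ideals.
Variables (F : fieldType) (A B : fieldExtType F).
Implicit Types M I J : {vspace tensor A B}.

(* a . x . b = (a (x) 1) * x * (1 (x) b) *)
Definition sub_bimodule M : Prop :=
  forall (a : A) (b : B) (x : tensor A B),
    x \in M -> tens a 1 * x * tens 1 b \in M.

Definition ideal I : Prop :=
  forall t x : tensor A B, x \in I -> t * x \in I.

Definition minimal_ideal I : Prop :=
  [/\ ideal I, I <> 0%VS &
      forall J, ideal J -> (J <= I)%VS -> J = 0%VS \/ J = I].

End Ideals.

Section Bisets.
Variables (F : fieldType) (L : splittingFieldType F) (K : {subfield L}).

Definition galois_closure : Prop :=
  galois 1 {:L} /\
  forall E : {subfield L}, (K <= E)%VS -> galois 1 E -> E = {:L}%VS :> {vspace L}.

Local Notation gT := (gal_of {:L}).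
Local Notation G := ('Gal({:L} / 1))%g.
Local Notation H := ('Gal({:L} / K))%g.
Local Notation T := (tensor (subvs_of K) (subvs_of K)).

(* The library's product of automorphisms is reversed composition
   ((x * y) a = y (x a)); two-sided notions such as bisets and double cosets
   HgH are unaffected. *)
Definition biset (S : {set gT}) : bool :=
  [&& S \subset G, (H * S)%g \subset S & (S * H)%g \subset S].

Definition pi_hom (g : gT) : 'Hom(T, L) :=
  linfun (tens_lift (fun a b : subvs_of K => vsval a * g (vsval b))).

Lemma pi_homE g a b : pi_hom g (tens a b) = vsval a * g (vsval b).
Proof.
pose f (a b : subvs_of K) : L := vsval a * g (vsval b).
pose fH := GRing.isLinear.Build F T L *:%R (tens_lift f) (tens_lift_linear f).
pose fL : {linear T -> L} := HB.pack (tens_lift f) fH.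
rewrite /pi_hom -[tens_lift _]/(fL : _ -> _) lfunE /= tens_liftE //.
  by move=> y c u v; rewrite /f linearP mulrDl scalerAl.
by move=> x c u v; rewrite /f !linearP mulrDr scalerAr.
Qed.

Lemma pi_hom_monoid g : monoid_morphism (pi_hom g).
Proof.
split; first by rewrite -[1]/(tens 1 1) pi_homE !rmorph1 mulr1.
move=> x y; elim/tens_ind: x => [a b|c u v Hu Hv]; last first.
  by rewrite mulrDl -scalerAl !linearP /= Hu Hv mulrDl scalerAl.
elim/tens_ind: y => [a' b'|c u v Hu Hv]; last first.
  by rewrite mulrDr -scalerAr !linearP /= Hu Hv mulrDr scalerAr.
by rewrite tensM !pi_homE !rmorphM mulrACA.
Qed.

(* K_[g], as a definite description (0 would be returned if there were not
   exactly one such ideal) *)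
Definition component (g : gT) : {vspace T} :=
  xget 0%VS (fun I => unique
    (fun J : {vspace T} => minimal_ideal J /\ ~ (J <= lker (pi_hom g))%VS) I).

(* K_[g] depends only on HgH, and a sum of subspaces is insensitive to
   repetitions, so the sum may be indexed by representatives g. *)
Definition biset_bimodule (S : {set gT}) : {vspace T} :=
  (\sum_(g in G | (H :* g * H)%g \subset S) component g)%VS.

End Bisets.

(* Main.v *)
From HB Require Import structures.
Require Import Defs.
From mathcomp Require Import all_boot all_order all_fingroup all_algebra.
From mathcomp Require Import all_solvable all_field.

(** The maps pi_g (for g in G) embed the commutative ring T = K (x)_F K into a
product of copies of L, and this turns every question about ideals of T into a
question about which pi_g vanish.

A sub-bimodule of T is the same as an ideal [sub_bimoduleP].  The embedding and
the separation of distinct double cosets both come from a primitive element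
theta of K/F: the element \sum_i a_i (x) theta^i of T can be read as the
polynomial q = \sum_i a_i X^i over K, and pi_g then becomes evaluation of q at
the conjugate g(theta).
- Every element of T is such a sum with fewer than [K : F] terms, whereas theta
  has [K : F] distinct conjugates; so an element killed by all pi_g is zero
  [pi_hom_inj].
- The polynomial whose roots are the conjugates d(theta) for d outside HgH has
  coefficients in K, and it does not vanish at g'(theta) for g' in HgH; so some
  element of T has nonzero image under pi_g' exactly for g' in HgH
  [pi_hom_separate].

The image of pi_g is a field, so the latter element can be normalized to one
whose image under pi_g' is 1 for g' in HgH and 0 otherwise: an idempotent e_g
[dcoset_idempotent].  It generates the ideal C_g of elements killed by pi_g' for
all g' outside HgH.  An ideal that pi_g does not kill contains an element of
image 1 under pi_g, which acts on C_g as the identity, so it contains C_g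
[ideal_absorb].  Hence C_g is minimal, and it is the component K_[g]
[componentE].

The biset attached to an ideal M is its support, the set of g with pi_g(M) <> 0.
The sum of the K_[g] over a biset S has support S because pi_g' is nonzero on
K_[g] only when g' is in HgH [ideal_support_biset].  Conversely M is the sum of
the K_[g] over its support: multiplication by the e_g splits an element of M
into its components [biset_bimodule_support]. *)

Set Implicit Arguments.
Unset Strict Implicit.
Unset Printing Implicit Defensive.

Import GRing.Theory.
Local Open Scope ring_scope.

(** * Ideals of a tensor product of fields *)

Section IdealsOfTensor.
Variables (F : fieldType) (A B : fieldExtType F).
Implicit Types (M I : {vspace tensor A B}) (x t : tensor A B).

HB.instance Definition _ a :=
  GRing.isLinear.Build F B (tensor A B) *:%R (tens a) (tens_linearr a).

Lemma tensZl c a b : tens (c *: a) b = c *: tens a b :> tensor A B.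
Proof. by apply/matrixP=> i j; rewrite !mxE linearZ mulrA. Qed.

Lemma tensZr c a b : tens a (c *: b) = c *: tens a b :> tensor A B.
Proof. by apply/matrixP=> i j; rewrite !mxE linearZ mulrCA. Qed.

(** The ring is commutative, so a two-sided action of pure tensors is the action
of a (x) b, and these span the ring. *)
Lemma sub_bimoduleP M : sub_bimodule M <-> ideal M.
Proof.
split=> [subM t x Mx | idM a b x Mx]; last first.
  by rewrite mulrAC tensM idM.
elim/tens_ind: t => [a b | c t u Mt Mu].
  by have := subM a b x Mx; rewrite mulrAC tensM mulr1 mul1r.
by rewrite mulrDl -scalerAl rpredD ?rpredZ.
Qed.

Lemma ideal_sumv (J : finType) (P : pred J) (I_ : J -> {vspace tensor A B}) :
  (forall j, P j -> ideal (I_ j)) -> ideal (\sum_(j | P j) I_ j)%VS.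
Proof.
move=> idI t x /memv_sumP[v_ Iv ->]; rewrite mulr_sumr.
by apply: memv_sumr => j Pj; apply: idI => //; apply: Iv.
Qed.

End IdealsOfTensor.

(** * Double cosets and the kernels of the maps pi_g *)

Section Correspondence.
Variables (F : fieldType) (L : splittingFieldType F) (K : {subfield L}).
Hypotheses (sepK : separable 1 K) (galL : galois 1 {:L}).

Local Notation gT := (gal_of {:L}).
Local Notation G := ('Gal({:L} / 1))%g.
Local Notation H := ('Gal({:L} / K))%g.
Local Notation KL := (subvs_of K).
Local Notation T := (tensor (subvs_of K) (subvs_of K)).
Local Notation dcoset g := (H :* g * H)%g.
Local Notation pi := (pi_hom K).

Implicit Types (g : gT) (x y : T) (M I J : {vspace T}) (S : {set gT}).

Lemma galHG : H \subset G.
Proof. exact/galS/sub1v. Qed.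

Lemma dcosetP g g' :
  reflect (exists h k, [/\ h \in H, k \in H & g' = h * g * k]%g)
          (g' \in dcoset g).
Proof.
apply: (iffP mulsgP) => [[_ k /rcosetP[h Hh ->] Hk ->] | [h [k [Hh Hk ->]]]].
  by exists h, k.
by exists (h * g)%g k => //; apply/rcosetP; exists h.
Qed.

Lemma dcoset_refl g : g \in dcoset g.
Proof. by apply/dcosetP; exists 1%g, 1%g; rewrite !group1 mul1g mulg1. Qed.

Lemma biset_dcoset S g : biset K S -> (dcoset g \subset S) = (g \in S).
Proof.
case/and3P=> _ HS SH; apply/idP/idP=> [/subsetP-> // | Sg].
  exact: dcoset_refl.
apply/subsetP=> _ /dcosetP[h [k [Hh Hk ->]]].
by apply: (subsetP SH); rewrite mem_mulg ?(subsetP HS) // mem_mulg.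
Qed.

Lemma pi_homM g x y : pi g (x * y) = pi g x * pi g y.
Proof. exact: (pi_hom_monoid K g).2. Qed.

(** In terms of composition of maps, h * g * k is k o g o h: h fixes the right
tensor factor, and k is pulled out because it fixes the left one. *)
Lemma pi_hom_dcosetM g h k x :
  h \in H -> k \in H -> pi (h * g * k)%g x = k (pi g x).
Proof.
move=> Hh Hk; elim/tens_ind: x => [a b | c u v Hu Hv].
  rewrite !pi_homE !galM ?memvf // rmorphM /=.
  have fixK (l : gT) (c : KL) : l \in H -> l (vsval c) = vsval c :> L.
    by move=> Hl; apply: (fixed_gal (subvf K) Hl); apply: subvsP.
  by rewrite (fixK _ _ Hh) (fixK _ _ Hk).
  by rewrite !linearP /= Hu Hv.
Qed.

Lemma pi_hom_dcoset_eq0 g g' x :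
  g' \in dcoset g -> (pi g' x == 0) = (pi g x == 0).
Proof.
by case/dcosetP=> h [k [Hh Hk ->]]; rewrite pi_hom_dcosetM // fmorph_eq0.
Qed.

(** The image of pi_g is a finite-dimensional subalgebra of the field L, hence
closed under inverses. *)
Lemma pi_hom_inv g x : pi g x != 0 -> exists y, pi g (y * x) = 1.
Proof.
move=> nz_x.
have asp : is_aspace (limg (pi g)).
  rewrite /is_aspace has_algid1 /=; last first.
    by rewrite -(pi_hom_monoid K g).1 memv_img ?memvf.
  apply/prodvP=> _ _ /memv_imgP[u _ ->] /memv_imgP[v _ ->].
  by rewrite -pi_homM memv_img ?memvf.
have: (pi g x)^-1 \in ASpace asp by rewrite memvV memv_img ?memvf.
case/memv_imgP=> y _ Dy; exists y.
by rewrite pi_homM -Dy mulVf.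
Qed.

(** * Evaluation at the conjugates of a primitive element *)

Let theta : L := separable_generator 1 K.

Fact theta_in : theta \in K.
Proof. exact: separable_generator_mem. Qed.

Let thetaK : KL := vsproj K theta.

Fact val_thetaK : vsval thetaK = theta.
Proof. by rewrite vsprojK ?theta_in. Qed.

Fact K_theta : K = <<1; theta>>%VS :> {vspace L}.
Proof. exact: eq_adjoin_separable_generator sepK (sub1v K). Qed.

Lemma gal_fixes_theta g : g \in G -> g theta = theta -> g \in H.
Proof.
move=> Gg fix_g; rewrite gal_kHom ?subvf //; apply/kHomP_tmp; split.
  move=> v; rewrite K_theta => /Fadjoin_poly_eq Dv.
  rewrite -{1}Dv -horner_map /= fix_g.
  by rewrite (fixedPoly_gal (sub1v _) Gg) ?Fadjoin_polyOver.
by move=> u v _ _; rewrite rmorphM.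
Qed.

Lemma rcoset_theta g g' :
  g \in G -> g' \in G -> g' theta = g theta -> g' \in (H :* g)%g.
Proof.
move=> Gg Gg' eq_th; rewrite mem_rcoset.
apply: gal_fixes_theta; first by rewrite groupM ?groupV.
by rewrite galM ?memvf // eq_th -galM ?memvf // mulgV gal_id.
Qed.

Lemma tens_theta_span x : exists p : nat -> KL,
  x = \sum_(i < adjoin_degree 1 theta) tens (p i) (thetaK ^+ i).
Proof.
elim/tens_ind: x => [a b | c x y [p ->] [q ->]]; last first.
  exists (fun i => c *: p i + q i); rewrite scaler_sumr -big_split.
  by apply: eq_bigr => i _; rewrite tens_linearl.
have Kb : vsval b \in <<1; theta>>%VS by rewrite -K_theta subvsP.
pose q := Fadjoin_poly 1 theta (vsval b).
have /polyOver1P[e De] : q \is a polyOver 1%VS by apply: Fadjoin_polyOver.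
have Db : b = \sum_(i < adjoin_degree 1 theta) e`_i *: thetaK ^+ i.
  apply: val_inj; rewrite /= -[LHS](Fadjoin_poly_eq Kb) linear_sum /=.
  rewrite (horner_coef_wide _ (size_Fadjoin_poly _ _ _)).
  apply: eq_bigr => i _; rewrite rmorphXn /= val_thetaK.
  by rewrite -/q De coef_map mulr_algl.
exists (fun i => e`_i *: a); rewrite [in LHS]Db linear_sum.
by apply: eq_bigr => i _; rewrite tensZl /= tensZr.
Qed.

(** The ring homomorphism pi_g is evaluation at the conjugate g(theta). *)
Lemma pi_hom_theta_sum n (p : nat -> KL) g :
  pi g (\sum_(i < n) tens (p i) (thetaK ^+ i)) =
    (\poly_(i < n) vsval (p i)).[g theta].
Proof.
rewrite linear_sum horner_poly /=; apply: eq_bigr => i _.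
by rewrite pi_homE !rmorphXn /= val_thetaK.
Qed.

(** A polynomial of degree less than [K : F] cannot vanish at all the [K : F]
distinct conjugates of theta. *)
Lemma pi_hom_inj x : (forall g, g \in G -> pi g x = 0) -> x = 0.
Proof.
have [p ->] := tens_theta_span x => pi0.
set q := \poly_(i < adjoin_degree 1 theta) vsval (p i).
have [r [/subsetP rG Ur Dmin]] := galois_factors (sub1v _) galL theta (memvf _).
have q0 : q = 0.
  apply: contraTeq (size_poly (adjoin_degree 1 theta) (fun i => vsval (p i))).
  move=> nz_q; rewrite -ltnNge.
  have := max_poly_roots nz_q _ Ur; rewrite size_map.
  have -> : size r = adjoin_degree 1 theta.
    have := size_minPoly 1 theta; rewrite Dmin size_prod_XsubC size_map.
    by case.
  apply; apply/allP=> _ /mapP[g rg ->]; apply/eqP.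
  by rewrite -pi_hom_theta_sum pi0 ?rG.
apply: big1 => i _; suff -> : p i = 0 by rewrite -[0](scale0r 1) tensZl scale0r.
apply: val_inj; rewrite linear0.
by move/polyP: q0 => /(_ i); rewrite coef0 coef_poly ltn_ord.
Qed.

(** The product of the X - d(theta) for d outside HgH is invariant under H,
which permutes its factors, so it has coefficients in K and defines an element
of the tensor product.  Its value at g'(theta) is nonzero for g' in HgH since
an equality g'(theta) = d(theta) forces H g' = H d. *)
Lemma pi_hom_separate g :
  exists x, forall g', g' \in G -> (pi g' x != 0) = (g' \in dcoset g).
Proof.
pose p : {poly L} := \prod_(d in G :\: dcoset g) ('X - (d theta)%:P).
have fix_p k : k \in H -> map_poly k p = p.
  move=> Hk; rewrite rmorph_prod [RHS](reindex_inj (mulIg k)) /=.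
  apply: eq_big => [d | d _]; last by rewrite map_polyXsubC galM ?memvf.
  (* d and d k lie in the same double coset *)
  rewrite !in_setD (groupMr _ (subsetP galHG k Hk)); congr (~~ _ && _).
  by rewrite -{4}(rcoset_id Hk) mulgA mem_rcoset mulgK.
have pK i : p`_i \in K.
  have /galois_fixedField <- : galois K {:L}.
    by apply: galoisS galL; rewrite sub1v subvf.
  apply/fixedFieldP=> [|k Hk]; first exact: memvf.
  by rewrite -{2}(fix_p k Hk) coef_map.
exists (\sum_(i < size p) tens (vsproj K p`_i) (thetaK ^+ i)) => g' Gg'.
rewrite (pi_hom_theta_sum _ (fun i => vsproj K p`_i)) /=.
have -> : \poly_(i < size p) vsval (vsproj K p`_i) = p.
  by rewrite -[RHS]coefK; apply: eq_poly => i _; rewrite vsprojK.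
rewrite horner_prod; have [gg' | gg'] := boolP (g' \in dcoset g).
  apply/prodf_neq0 => d; rewrite inE => /andP[gd Gd].
  rewrite hornerXsubC subr_eq0; apply: contra gd => /eqP eq_th.
  have /dcosetP[h [k [Hh Hk Dg']]] := gg'.
  have /rcosetP[l Hl ->] := rcoset_theta Gg' Gd (esym eq_th).
  by apply/dcosetP; exists (l * h)%g, k; rewrite groupM // Dg' !mulgA.
apply/negbF/prodf_eq0; exists g'; first by rewrite inE gg'.
by rewrite hornerXsubC subrr.
Qed.

Lemma dcoset_idempotent g : g \in G ->
  exists e, forall g', g' \in G -> pi g' e = (g' \in dcoset g)%:R.
Proof.
move=> Gg; have [x x0] := pi_hom_separate g.
have [y yx1] : exists y, pi g (y * x) = 1.
  by apply: pi_hom_inv; rewrite x0 ?dcoset_refl.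
exists (y * x) => g' Gg'; have [| gg'] := boolP (g' \in dcoset g); last first.
  by apply/eqP; rewrite pi_homM mulf_eq0 -[pi g' x == 0]negbK x0 // gg' orbT.
by case/dcosetP=> h [k [Hh Hk ->]]; rewrite pi_hom_dcosetM // yx1 rmorph1.
Qed.

(** * The components K_[g] *)

(** This turns out to be K_[g]; the description by kernels, unlike the one as
the ideal generated by an idempotent, involves no choice. *)
Definition dcoset_ideal g : {vspace T} :=
  (\bigcap_(g' in (G :\: dcoset g)%SET) lker (pi g'))%VS.

Lemma dcoset_idealP g x :
  reflect (forall g', g' \in G -> g' \notin dcoset g -> pi g' x = 0)
          (x \in dcoset_ideal g).
Proof.
rewrite memvE; apply: (iffP subv_bigcapP) => [x0 g' Gg' gg' | x0 g'].
  by apply/eqP; rewrite -memv_ker memvE x0 // inE gg'.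
by rewrite inE -memvE memv_ker => /andP[gg' Gg']; apply/eqP/x0.
Qed.

Lemma ideal_dcoset_ideal g : ideal (dcoset_ideal g).
Proof.
move=> t x /dcoset_idealP x0; apply/dcoset_idealP => g' Gg' gg'.
by rewrite pi_homM x0 ?mulr0.
Qed.

(** Some w in I has image 1 under pi_g, hence under pi_g' for every g' in HgH.
Then x and x * w have the same image under every pi_g': for g' outside HgH both
images are 0. *)
Lemma ideal_absorb I g x : ideal I -> x \in dcoset_ideal g ->
  ~ (I <= lker (pi g))%VS -> x \in I.
Proof.
move=> idI /dcoset_idealP x0 /negP/subvPn[u Iu].
rewrite memv_ker => /pi_hom_inv[y yu1].
suff -> : x = x * (y * u) by do 2!apply: (idI).
apply/eqP; rewrite -subr_eq0; apply/eqP/pi_hom_inj => g' Gg'.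
rewrite linearB /= pi_homM -[X in X - _]mulr1 -mulrBr.
have [| gg'] := boolP (g' \in dcoset g); last by rewrite x0 ?mul0r.
case/dcosetP=> h [k [Hh Hk ->]].
by rewrite [pi _ (y * u)]pi_hom_dcosetM // yu1 rmorph1 subrr mulr0.
Qed.

(** The idempotent of HgH lies in the ideal, and pi_g' sends it to 1 for g' in
HgH. *)
Lemma dcoset_ideal_lker g g' : g \in G -> g' \in G ->
  (dcoset_ideal g <= lker (pi g'))%VS = (g' \notin dcoset g).
Proof.
move=> Gg Gg'; apply/idP/idP=> [/subvP sub_g' | gg'].
  have [e De] := dcoset_idempotent Gg.
  have /sub_g' : e \in dcoset_ideal g.
    by apply/dcoset_idealP => d Gd /negbTE gd; rewrite De // gd.
  by rewrite memv_ker De //; case: (_ \in _); rewrite ?oner_eq0.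
by apply/subvP=> x /dcoset_idealP x0; rewrite memv_ker x0.
Qed.

(** If pi_g kills a smaller ideal J then so do all the other pi_g': those with
g' in HgH have the same kernel, and those with g' outside kill the whole
ideal. *)
Lemma dcoset_ideal_minimal g : g \in G -> minimal_ideal (dcoset_ideal g).
Proof.
move=> Gg; split; first exact: ideal_dcoset_ideal.
  move=> C0; have := dcoset_ideal_lker Gg Gg.
  by rewrite C0 sub0v dcoset_refl.
move=> J idJ sJC.
have [sJg | nsJg] := boolP (J <= lker (pi g))%VS; [left | right].
  apply/eqP; rewrite -subv0; apply/subvP=> x Jx; rewrite memv0; apply/eqP.
  have /dcoset_idealP x0 := subvP sJC x Jx.
  apply: pi_hom_inj => g' Gg'; have [gg' | /x0-> //] := boolP (g' \in dcoset g).
  by apply/eqP; rewrite (pi_hom_dcoset_eq0 _ gg') -memv_ker (subvP sJg).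
apply: subv_anti; rewrite sJC; apply/subvP=> x Cx.
by apply: ideal_absorb Cx _; last apply/negP.
Qed.

(** A minimal ideal that pi_g does not kill contains [dcoset_ideal g], hence
equals it. *)
Lemma componentE g : g \in G -> component K g = dcoset_ideal g.
Proof.
move=> Gg; have nCg : ~ (dcoset_ideal g <= lker (pi g))%VS.
  by rewrite dcoset_ideal_lker // dcoset_refl.
rewrite /component; set P := unique _.
suff PC : P (dcoset_ideal g).
  have [_ uniqX] := classical_sets.xgetPex 0%VS (ex_intro _ _ PC).
  exact: uniqX PC.1.
split=> [|J [[idJ nzJ minJ] nJg]].
  by split; first exact: dcoset_ideal_minimal.
have sCJ : (dcoset_ideal g <= J)%VS.
  by apply/subvP=> x Cx; apply: ideal_absorb Cx nJg.
have [C0 | //] := minJ _ (@ideal_dcoset_ideal g) sCJ.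
by case: nCg; rewrite C0 sub0v.
Qed.

(** * Ideals and their supports *)

Lemma ideal_biset_bimodule S : ideal (biset_bimodule K S).
Proof.
apply: ideal_sumv => g /andP[Gg _].
by rewrite componentE //; apply: ideal_dcoset_ideal.
Qed.

Definition ideal_support M : {set gT} :=
  [set g in G | ~~ (M <= lker (pi g))%VS].

Lemma in_ideal_support M g :
  (g \in ideal_support M) = (g \in G) && ~~ (M <= lker (pi g))%VS.
Proof. by rewrite in_set. Qed.

Lemma biset_ideal_support M : biset K (ideal_support M).
Proof.
have suppM g h k : g \in ideal_support M -> h \in H -> k \in H ->
    (h * g * k)%g \in ideal_support M.
  rewrite !in_ideal_support => /andP[Gg /subvPn[x Mx x0]] Hh Hk.
  have Gh := subsetP galHG h Hh; have Gk := subsetP galHG k Hk.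
  apply/andP; split; first by rewrite !groupM.
  apply/subvPn; exists x => //.
  by move: x0; rewrite !memv_ker pi_hom_dcosetM // fmorph_eq0.
apply/and3P; split; apply/subsetP=> g.
- by rewrite in_ideal_support => /andP[].
- by case/mulsgP=> h d Hh Sd ->; rewrite -[(h * d)%g]mulg1 suppM.
by case/mulsgP=> d k Sd Hk ->; rewrite -[d]mul1g suppM.
Qed.

Lemma ideal_support_biset S :
  biset K S -> ideal_support (biset_bimodule K S) = S.
Proof.
move=> bS; have /and3P[/subsetP SG _ _] := bS.
apply/setP=> g; rewrite in_ideal_support.
have [Gg | nGg] := boolP (g \in G); last first.
  by apply/esym/negbTE; apply: contra nGg => /SG.
apply/idP/idP=> [|Sg].
  apply: contraR => nSg; apply/subv_sumP=> d /andP[Gd].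
  rewrite biset_dcoset // => Sd; rewrite componentE // dcoset_ideal_lker //.
  by apply: contra nSg; apply/subsetP; rewrite biset_dcoset.
apply/negP=> /subv_sumP/(_ g); rewrite Gg biset_dcoset // => /(_ Sg).
by rewrite componentE // dcoset_ideal_lker // dcoset_refl.
Qed.

(** An element x of M is approximated by elements w of the sum W of components,
correcting the error at one automorphism g at a time: adding e_g * (x - w) to w
makes the image of x - w under pi_g zero and keeps the zeros already obtained.
Outside the support there is nothing to correct.  Once x - w vanishes under all
pi_g, x = w. *)
Lemma biset_bimodule_support M :
  ideal M -> biset_bimodule K (ideal_support M) = M.
Proof.
set S := ideal_support M; set W := biset_bimodule K S => idM.
have idW : ideal W by apply: ideal_biset_bimodule.
have bS : biset K S by apply: biset_ideal_support.
have sWM : (W <= M)%VS.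
  apply/subv_sumP=> g /andP[Gg]; rewrite biset_dcoset // componentE //.
  rewrite in_ideal_support => /andP[_ /negP nMg]; apply/subvP=> x Cx.
  exact: ideal_absorb Cx nMg.
apply: subv_anti; rewrite sWM; apply/subvP=> x Mx.
have approx (s : seq gT) : {subset s <= G} ->
    exists2 w, w \in W & forall g, g \in s -> pi g (x - w) = 0.
  elim: s => [|g s IHs] sG; first by exists 0; rewrite ?mem0v.
  have Gg : g \in G by rewrite sG ?mem_head.
  have [d sd|w Ww w0] := IHs; first by rewrite sG // inE sd orbT.
  have [Sg | nSg] := boolP (g \in S); last first.
    exists w => // d; rewrite inE => /predU1P[-> | /w0 //].
    apply/eqP; rewrite -memv_ker.
    move: nSg; rewrite in_ideal_support Gg negbK => /subvP-> //.
    by rewrite rpredB // (subvP sWM).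
  have [e De] := dcoset_idempotent Gg.
  exists (w + e * (x - w)).
    rewrite rpredD // mulrC; apply: idW.
    apply: subvP (sumv_sup g _ (subvv _)) _ _.
      by rewrite Gg biset_dcoset.
    rewrite componentE //; apply/dcoset_idealP => d Gd /negbTE gd.
    by rewrite De // gd.
  move=> d sd; rewrite opprD addrA -[X in X - _]mul1r -mulrBl.
  rewrite pi_homM linearB /=.
  move: sd; rewrite inE => /predU1P[-> | /w0->]; last by rewrite mulr0.
  by rewrite De // dcoset_refl (pi_hom_monoid K g).1 subrr mul0r.
have [|w Ww w0] := approx (enum G); first by move=> g; rewrite mem_enum.
suff -> : x = w by [].
apply/eqP; rewrite -subr_eq0; apply/eqP/pi_hom_inj => g Gg.
by rewrite w0 ?mem_enum.
Qed.

End Correspondence.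

Theorem corollary9 (F : fieldType) (L : splittingFieldType F)
    (K : {subfield L}) (sepK : separable 1 K) (clK : galois_closure K) :
  (forall S : {set gal_of {:L}}, biset K S ->
     sub_bimodule (biset_bimodule K S)) /\
  (forall M : {vspace tensor (subvs_of K) (subvs_of K)}, sub_bimodule M ->
     exists! S : {set gal_of {:L}}, biset K S /\ biset_bimodule K S = M).
Proof.
have [galL _] := clK; split=> [S bS | M /sub_bimoduleP idM].
  exact/sub_bimoduleP/ideal_biset_bimodule.
exists (ideal_support M).
split=> [|S [bS <-]]; last exact: ideal_support_biset.
by split; [apply: biset_ideal_support | apply: biset_bimodule_support].
Qed.
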